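(* Let $\kappa:\mathbb{N}\to\mathbb{R}$ be an increasing function with $\kappa(n)\le n/4$, such that the process $\mathbf{P}^\star$ satisfies the large-scale typicality property with cutoff $\rho(n)=\kappa(2n)$ (with constant $\eta<1$). Then there is a nonrandom constant $C_0>0$, depending only on $\eta$, such that $$\sup_{r^\star<r<\kappa(n)}\frac{1}{|\mathsf{A}|^r}\left\{\sup_{\mathbf{P}\in\Theta^r}\log\mathbf{P}(x_{1:n})-\sup_{\mathbf{P}\in\Theta^{r^\star}}\log\mathbf{P}(x_{1:n})\right\}\le C_0\log\log n$$ eventually as $n\to\infty$, $\mathbf{P}^\star$-a.s. (i.e. $\mathbf{P}^\star$-almost surely there is a random $n_0$ such that the inequality holds for all $n\ge n_0$).
   Context: Fix once and for all an alphabet $\mathsf{A}$ of finite cardinality $|\mathsf{A}|<\infty$. Let $\Omega=\mathsf{A}^{\mathbb{N}}$ with its Borel $\sigma$-field and coordinate process $(X_k)_{k\ge1}$. Write $x_{m:n}=(x_m,\ldots,x_n)$, and $\mathbf{P}(x_{m:n})$, $\mathbf{P}(x_{m:n}|x_{r:s})$ for $\mathbf{P}(X_{m:n}=x_{m:n})$, $\mathbf{P}(X_{m:n}=x_{m:n}|X_{r:s}=x_{r:s})$; in random expressions $x_{1:n}$ is the observed path $X_{1:n}$. The variable $r$ always ranges over nonnegative integers. For $r\ge0$, $\Theta^r$ is the set of all probability measures $\mathbf{P}$ on $\Omega$ that are time-homogeneous Markov chains of order at most $r$: $\mathbf{P}(x_{1:n})=\mathbf{P}(x_{1:r})\prod_{i=r+1}^n\mathbf{P}(x_i|x_{i-r:i-1})$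 for all $n\ge r$ and $x_{1:n}\in\mathsf{A}^n$, where $\mathbf{P}(X_i=x_{r+1}|X_{i-r:i-1}=x_{1:r})=\mathbf{P}(x_{r+1}|x_{1:r})$ for all $i>r$ and $x_{1:r+1}\in\mathsf{A}^{r+1}$ (so $\mathbf{P}$ is given by an arbitrary initial law on $\mathsf{A}^r$ and an arbitrary transition kernel from $\mathsf{A}^r$ to $\mathsf{A}$; $\Theta^0$ is the class of i.i.d. laws). The order of a Markov chain $\mathbf{P}$ is the smallest $r$ with $\mathbf{P}\in\Theta^r$. $\mathbf{P}^\star$ is a fixed Markov chain of order $r^\star$, assumed stationary and irreducible (any $r^\star$-block of positive probability can be reached with positive probability from any other such block). For $a_{1:r}\in\mathsf{A}^r$ and $n\ge1$ let $N_n(a_{1:r})=\sum_{i=r+1}^n\mathbf{1}_{x_{i-r:i-1}=a_{1:r}}$ (for $r=0$ the empty word has probability $1$ and $N_n=n$). The process $\mathbf{P}^\star$ satisfies the large-scale typicality property with cutoff $\rho(n)$ if there is a constant $\eta<1$ such that, $\mathbf{P}^\star$-a.s., eventually as $n\to\infty$, $$\left|\frac{1}{\mathbf{P}^\star(a_{1:r})}\frac{N_n(a_{1:r})}{n-r}-1\right|<\eta\quad\text{for all }a_{1:r}\in\mathsf{A}^r\text{ with }\mathbf{P}^\star(a_{1:r})>0,\ r<\rho(n).$$ *)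

(* Defs.v *)
From HB Require Import structures.
From mathcomp Require Import all_boot all_order all_algebra.
From mathcomp Require Import all_classical all_reals all_analysis.

Set Implicit Arguments.
Unset Strict Implicit.
Unset Printing Implicit Defensive.

Import Order.TTheory GRing.Theory Num.Theory.

Local Open Scope classical_set_scope.
Local Open Scope ring_scope.

(* A finite alphabet; pointedness (i.e. nonemptiness) is what the library
   requires to put a sigma-algebra on the path space. *)
#[short(type="alphabetType")]
HB.structure Definition Alphabet := {A of Finite A & Pointed A}.

(* Letters are indexed from 0: the coordinate X_k of the literature (k >= 1)
   is fun w => w k.-1. *)
Definition pathspace (A : alphabetType) :=
  g_sigma_algebraType (@open (prod_topology (fun _ : nat => discrete_topology A))).

Section paths.
Variable A : alphabetType.

(* block w m r is the word (X_{m+1}, ..., X_{m+r}) read along the path w. *)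
Definition block (w : nat -> A) (m r : nat) : r.-tuple A :=
  [tuple w (m + i)%N | i < r].

Definition block_event (m r : nat) (a : r.-tuple A) : set (pathspace A) :=
  [set w | block w m r = a].

Definition shift (w : pathspace A) : pathspace A := fun k => w k.+1.

(* N_n(a) along the path w: only occurrences of a ending at a position at most
   n - 1 are counted. *)
Definition occ (w : nat -> A) (n r : nat) (a : r.-tuple A) : nat :=
  \sum_(r <= i < n) (block w (i - r) r == a).

End paths.

Section markov.
Context {R : realType} {A : alphabetType}.
Implicit Type P : probability (pathspace A) R.

Definition prob P (E : set (pathspace A)) : R := fine (P E).

(* Conditional probability; meaningful only when prob P F > 0. *)
Definition cprob P (E F : set (pathspace A)) : R :=
  prob P (E `&` F) / prob P F.

(* Theta^r.  The kernel Q provides the values of P(x_{r+1} | x_{1:r}), also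
   for the words x_{1:r} on which conditioning is undefined.  Quantifying over
   infinite paths x amounts to quantifying over the finite words x_{1:n}. *)
Definition Theta (r : nat) : set (probability (pathspace A) R) :=
  [set P | exists Q : r.-tuple A -> A -> R,
    [/\ (forall a b, 0 <= Q a b),
        (forall a, \sum_(b : A) Q a b = 1),
        (forall (m : nat) (a : r.-tuple A) (b : A),
           0 < prob P (block_event m a) ->
           cprob P [set w | w (m + r)%N = b] (block_event m a) = Q a b)
      & forall (x : nat -> A) (n : nat), (r <= n)%N ->
          prob P (block_event 0 (block x 0 n)) =
          prob P (block_event 0 (block x 0 r)) *
            \prod_(r <= i < n) Q (block x (i - r) r) (x i)]].

Definition has_order P (r : nat) : Prop :=
  Theta r P /\ forall r', Theta r' P -> (r <= r')%N.

Definition stationary P : Prop :=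
  forall E : set (pathspace A), measurable E -> P (@shift A @^-1` E) = P E.

Definition irreducible P (r : nat) : Prop :=
  forall a b : r.-tuple A,
    0 < prob P (block_event 0 a) -> 0 < prob P (block_event 0 b) ->
    exists m : nat, 0 < cprob P (block_event m b) (block_event 0 a).

(* Large-scale typicality with cutoff rho and constant eta. *)
Definition large_scale_typical P (rho : nat -> R) (eta : R) : Prop :=
  {ae P, forall w : pathspace A, \forall n \near \oo,
    forall (r : nat) (a : r.-tuple A),
      r%:R < rho n -> 0 < prob P (block_event 0 a) ->
      `| (prob P (block_event 0 a))^-1 * ((occ w n a)%:R / (n%:R - r%:R)) - 1 |
        < eta}.

(* sup_{P in Theta^r} log P(x_{1:n}), where log 0 = -oo. *)
Definition max_loglik (r n : nat) (w : pathspace A) : \bar R :=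
  ereal_sup [set lne (P (block_event 0 (block w 0 n))) | P in Theta r].

End markov.

(* Main.v *)
(* Let [p] be the transition kernel of the true chain, and for a word [a] of
   length [r] and a letter [b] let [N_a], [N_ab] count the occurrences of [a] and
   of [a] followed by [b].  For any kernel [q] of order [r], the log-likelihood
   ratio of [q] against [p] is at most
     \sum_(a, b) (N_ab ln (q_ab / p_ab) - (q_ab / p_ab - 1) N_a p_ab),
   because the rows of [q] and [p] have the same sum.  For a fixed [g] in place of
   [q / p], the exponential of this sum is a supermartingale, and it factors over
   the pairs (a, b), so one may mix each factor separately over a grid of values
   of [g_ab].  Typicality confines [N_a p_ab] to a deterministic interval
   [[K, L K]] while [n] ranges over [[2^k, 2^(k+1)]], and for such values a grid of
   spacing [1 / sqrt K] in the variable [sqrt g_ab], with weights decaying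
   geometrically away from [g_ab = 1], recovers half of the maximal exponent up to
   an additive constant.  Hence half of the log-likelihood ratio is at most the
   logarithm of the mixture plus [O(|A|^(r+1))].  By Ville's maximal inequality
   the mixture exceeds [(k+1)(k+2)2^(r+1)] with a probability summable over [k]
   and [r], and Borel-Cantelli concludes since [ln k] is [ln (ln n) + O(1)]. *)

Require Import Defs.
From mathcomp Require Import all_boot all_order all_algebra.
From mathcomp Require Import all_classical all_reals all_analysis.
From mathcomp Require Import ring lra zify.

Set Implicit Arguments.
Unset Strict Implicit.
Unset Printing Implicit Defensive.

Import Order.TTheory GRing.Theory Num.Theory.

Local Open Scope classical_set_scope.
Local Open Scope ring_scope.

(** * The one-dimensional grid *)

Lemma ln_le_subr1 {R : realType} (x : R) : 0 < x -> ln x <= x - 1.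
Proof.
by move=> x0; have := @le_ln1Dx R (x - 1); rewrite [1 + _]addrC subrK; apply; lra.
Qed.

(* The contribution of one pair (a, b), with [x = N_ab], [T = N_a p_ab] and
   [y = q_ab / p_ab]. *)
Definition pexp {R : realType} (x T y : R) : R := x * ln y - (y - 1) * T.

(* The maximum of [pexp x T] over [y], attained at [y = x / T]; correct at
   [x = 0] because [ln 0 = 0]. *)
Definition pmax {R : realType} (x T : R) : R := x * ln (x / T) - x + T.

Lemma pexp_le_pmax {R : realType} (x T y : R) : 0 < T -> 0 <= x -> 0 <= y ->
  (0 < x -> 0 < y) -> pexp x T y <= pmax x T.
Proof.
move=> T0 x0 y0 xy; rewrite /pexp /pmax.
have [x_gt0|xle0] := ltP 0 x; last first.
  have -> : x = 0 by lra.
  by rewrite !mul0r; have := mulr_ge0 y0 (ltW T0); lra.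
have {xy}y_gt0 := xy x_gt0.
have z0 : 0 < y / (x / T) by rewrite divr_gt0 // divr_gt0.
have := ln_le_subr1 z0; rewrite ln_div ?posrE ?divr_gt0 // => H.
have : x * (ln y - ln (x / T)) <= x * (y / (x / T) - 1) by rewrite ler_pM2l.
have -> : x * (y / (x / T) - 1) = y * T - x by field; rewrite !gt_eqF.
by rewrite mulrBr; lra.
Qed.

(** Apply [ln t <= t - 1] at [t = sqrt (T / x)]: a Poisson relative entropy dominates a squared
    Hellinger-type distance. This pays for the grid weights, which decay with distance in the scale
    [sqrt y]. *)
Lemma hellinger_le_pmax {R : realType} (x T : R) : 0 < T -> 0 <= x ->
  (Num.sqrt x - Num.sqrt T) ^+ 2 <= pmax x T.
Proof.
move=> T0 x0; rewrite /pmax.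
have [x_gt0|xle0] := ltP 0 x; last first.
  have -> : x = 0 by lra.
  rewrite sqrtr0 mul0r !sub0r sqrrN sqr_sqrtr; last exact: ltW. by rewrite oppr0 add0r.
set a := Num.sqrt x; set b := Num.sqrt T.
have a0 : 0 < a by rewrite sqrtr_gt0.
have b0 : 0 < b by rewrite sqrtr_gt0.
have -> : x = a ^+ 2 by rewrite sqr_sqrtr.
have -> : T = b ^+ 2 by rewrite sqr_sqrtr // ltW.
have ba : 0 < b / a by rewrite divr_gt0.
have -> : ln (a ^+ 2 / b ^+ 2) = - (ln (b / a) *+ 2).
  by rewrite -lnXn // -lnV ?posrE ?exprn_gt0 // expr_div_n invf_div.
have := ln_le_subr1 ba => H.
have : a ^+ 2 * ln (b / a) <= a ^+ 2 * (b / a - 1).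
  by rewrite ler_pM2l ?exprn_gt0.
have -> : a ^+ 2 * (b / a - 1) = a * b - a ^+ 2 by field; rewrite gt_eqF.
by rewrite mulrN mulrnAr; lra.
Qed.

(* In the scale [sqrt y], overshooting the maximiser by at most [1 / sqrt K]
   costs [O(T / K)], however small the maximiser is. *)
Lemma pexp_near_max {R : realType} (x T K z : R) : 0 < T -> 0 < K -> 0 <= x ->
  let v := Num.sqrt K * Num.sqrt (x / T) in v < z -> z <= v + 1 ->
  pmax x T - 3 * (T / K) <= pexp x T (z ^+ 2 / K).
Proof.
move=> T0 K0 x0 v vz zv; rewrite /pexp /pmax.
have v0 : 0 <= v by rewrite mulr_ge0 ?sqrtr_ge0.
have z0 : 0 < z by lra.
have vE : v ^+ 2 = K * (x / T).
  by rewrite exprMn !sqr_sqrtr ?divr_ge0 ?(ltW K0) ?(ltW T0).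
have [x_gt0|xle0] := ltP 0 x; last first.
  have x0' : x = 0 by lra.
  have vv : v = 0 by rewrite /v x0' mul0r sqrtr0 mulr0.
  rewrite x0' !mul0r.
  have : z ^+ 2 * (T / K) <= 1 * (T / K).
    by rewrite ler_wpM2r ?divr_ge0 ?(ltW T0) ?(ltW K0) // expr_le1 ?(ltW z0) //; lra.
  have : 0 <= T / K by rewrite divr_ge0 ?(ltW T0) ?(ltW K0).
  have -> : (z ^+ 2 / K - 1) * T = z ^+ 2 * (T / K) - T by field; rewrite gt_eqF.
  by lra.
have {v0}v0 : 0 < v by rewrite mulr_gt0 // sqrtr_gt0 // divr_gt0.
have xE : x = T * v ^+ 2 / K by rewrite vE; field; rewrite !gt_eqF.
have vz0 : 0 < v / z by rewrite divr_gt0.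
have lnE : ln (z ^+ 2 / K) = ln (x / T) - ln (v / z) *+ 2.
  rewrite -lnXn // -ln_div ?posrE ?exprn_gt0 ?divr_gt0 //; congr ln.
  by rewrite xE; field; rewrite !gt_eqF.
have := ln_le_subr1 vz0 => H.
have : x * ln (v / z) <= x * (v / z - 1) by rewrite ler_pM2l.
rewrite lnE [x * (_ - _ *+ 2)]mulrBr mulrnAr.
set l := x * ln (x / T); set m := x * ln (v / z) => Hm.
suff : x * (v / z - 1) *+ 2 - x + z ^+ 2 / K * T <= 3 * (T / K) by lra.
(* Since [0 < d <= 1] and [v / z <= 1], the factor of [T / K] below is at most [2 + 1], whence the
   constant 3. *)
pose d := z - v.
have -> : x * (v / z - 1) *+ 2 - x + z ^+ 2 / K * T =
   (T / K) * (2 * (v / z) * d ^+ 2 + d ^+ 2).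
  by rewrite xE /d; field; rewrite !gt_eqF.
rewrite [leRHS]mulrC ler_pM2l ?divr_gt0 //.
have vz1 : v / z <= 1 by rewrite ler_pdivrMr // mul1r ltW.
have d1 : d ^+ 2 <= 1 by rewrite expr_le1 // /d; lra.
have : v / z * d ^+ 2 <= 1 * 1 by apply: ler_pM; rewrite ?sqr_ge0 ?(ltW vz0).
lra.
Qed.

Definition grid_pt {R : realType} (K : R) (j : nat) : R := j.+1%:R ^+ 2 / K.

(* Index of a grid point within one step (in the scale [sqrt y]) of 1. *)
Definition grid_ctr {R : realType} (K : R) : nat := Num.trunc (Num.sqrt K).

(** The two truncated differences add up to the distance from [j] to the centre. The divisor 4
    covers the two geometric series on either side, each at most 2. *)
Definition grid_wt {R : realType} (K : R) (j : nat) : R :=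
  2^-1 ^+ ((j - grid_ctr K) + (grid_ctr K - j)) / 4.

Lemma grid_pt_gt0 {R : realType} (K : R) j : 0 < K -> 0 < grid_pt K j.
Proof. by move=> K0; rewrite divr_gt0 // exprn_gt0. Qed.

Lemma grid_wt_ge0 {R : realType} (K : R) j : 0 <= grid_wt K j.
Proof. by rewrite divr_ge0 // exprn_ge0 // invr_ge0. Qed.

Lemma sum_half_le2 {R : realType} (m : nat) : \sum_(i < m) (2^-1 : R) ^+ i <= 2.
Proof.
have /eqP := subrX1 (2^-1 : R) m; rewrite -subr_eq0 => /eqP.
have : 0 <= (2^-1 : R) ^+ m by rewrite exprn_ge0 // invr_ge0.
by set s := \sum_(i < m) _; set t := _ ^+ m; lra.
Qed.

Lemma sum_grid_wt {R : realType} (K : R) (J : nat) :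
  \sum_(j < J) grid_wt K j <= 1.
Proof.
rewrite /grid_wt -mulr_suml ler_pdivrMr // mul1r; move: (grid_ctr K) => c.
rewrite -(big_mkord xpredT (fun j => 2^-1 ^+ (j - c + (c - j)))).
(* Padding the range up to [c + J] allows cutting at [c] even when [J < c]. *)
have le_cat : \sum_(0 <= j < J) (2^-1 : R) ^+ (j - c + (c - j)) <=
    \sum_(0 <= j < c + J) 2^-1 ^+ (j - c + (c - j)).
  rewrite [leRHS](big_cat_nat (leq0n J) (leq_addl c J)) /= lerDl.
  by apply: sumr_ge0 => i _; rewrite exprn_ge0 // invr_ge0.
apply: le_trans le_cat _.
rewrite (big_cat_nat (leq0n c) (leq_addr J c)) /=.
have -> : (4 : R) = 2 + 2 by ring.
apply: lerD.
  apply: le_trans (sum_half_le2 c.+1); rewrite big_nat_rev big_mkord /= add0n.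
  rewrite big_ord_recl ler_wpDl ?exprn_ge0 ?invr_ge0 //.
  rewrite le_eqVlt; apply/orP; left; apply/eqP; apply: eq_bigr => i _.
  by congr (_ ^+ _); case: i => i ic; rewrite /= /bump; lia.
rewrite -{1}[c]add0n big_addn addKn big_mkord.
apply: le_trans (sum_half_le2 J); rewrite le_eqVlt; apply/orP; left; apply/eqP.
by apply: eq_bigr => i _; congr (_ ^+ _); lia.
Qed.

Lemma ln2_le1 {R : realType} : ln (2 : R) <= 1.
Proof. by have := @ln_le_subr1 R 2 (ltr0Sn R 1); lra. Qed.

Lemma ln_grid_wt {R : realType} (K : R) (j : nat) :
  - ((j - grid_ctr K) + (grid_ctr K - j))%:R - 2 <= ln (grid_wt K j).
Proof.
rewrite /grid_wt; set d := addn _ _.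
have h0 : 0 < (2^-1 : R) by rewrite invr_gt0.
rewrite ln_div ?posrE ?exprn_gt0 // lnXn // lnV ?posrE //.
have -> : (4 : R) = 2 ^+ 2 by ring.
rewrite lnXn // mulNrn.
have := @ln2_le1 R; set l := ln 2 => l1.
have : l *+ d <= d%:R by rewrite -[l *+ d]mulr_natr ler_piMl.
by move=> ?; lra.
Qed.

Lemma ln_sum_ge {R : realType} (I : finType) (F : I -> R) (i : I) :
  (forall j, 0 <= F j) -> 0 < F i -> ln (F i) <= ln (\sum_j F j).
Proof.
move=> F0 Fi; have le : F i <= \sum_j F j.
  by rewrite (bigD1 i) //= lerDl sumr_ge0.
by rewrite ler_ln ?posrE // (lt_le_trans Fi).
Qed.

Definition grid_mix {R : realType} (K : R) (J x : nat) (T : R) : R :=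
  \sum_(j < J) grid_wt K j * (grid_pt K j ^+ x * expR (- ((grid_pt K j - 1) * T))).

Lemma ln_grid_mix_ge {R : realType} (K T : R) (J x j : nat) :
  0 < K -> (j < J)%N ->
  ln (grid_wt K j) + pexp x%:R T (grid_pt K j) <= ln (grid_mix K J x T).
Proof.
move=> K0 jJ.
have p0 i : 0 < grid_pt K i ^+ x * expR (- ((grid_pt K i - 1) * T)).
  by rewrite mulr_gt0 ?expR_gt0 // exprn_gt0 // grid_pt_gt0.
have w0 i : 0 < grid_wt K i by rewrite divr_gt0 // exprn_gt0 // invr_gt0.
have := @ln_sum_ge R _ (fun i : 'I_J => grid_wt K i *
   (grid_pt K i ^+ x * expR (- ((grid_pt K i - 1) * T)))) (Ordinal jJ).
rewrite -/(grid_mix K J x T) /= => H; apply: le_trans (H _ _).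
- by rewrite !lnM ?posrE ?exprn_gt0 ?grid_pt_gt0 ?expR_gt0 // expRK
    lnXn ?grid_pt_gt0 // /pexp mulr_natl.
- by move=> i; rewrite ltW // mulr_gt0.
- by rewrite mulr_gt0.
Qed.

(** Keep only the grid point just above the maximiser, which loses at most [3 * L]. Its weight costs
    its distance [d] to the centre, and [d] is at most [|v - s| + 1], with [v] and [s] the positions
    of the maximiser and of 1 in grid units. As [|v - s| <= (1 + (v - s)^2) / 2] and
    [(v - s)^2 <= pmax x T], half of the maximum survives. *)
Lemma grid_mix_bound {R : realType} (K L T y : R) (J x : nat) :
  0 < K -> 0 <= L -> K <= T -> T <= L * K -> (x <= J)%N -> 0 <= y ->
  ((0 < x)%N -> 0 < y) ->
  2^-1 * pexp x%:R T y <= ln (grid_mix K J.+2 x T) + (3 * L + 4).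
Proof.
move=> K0 L0 KT TLK xJ y0 xy.
have T0 : 0 < T by exact: lt_le_trans KT.
have x0 : 0 <= x%:R :> R by [].
have := @pexp_le_pmax R x%:R T y T0 x0 y0; rewrite ltr0n => /(_ xy) yE.
set v := Num.sqrt K * Num.sqrt (x%:R / T).
have v0 : 0 <= v by rewrite mulr_ge0 ?sqrtr_ge0.
pose j := Num.trunc v.
have /andP[jv vj] : j%:R <= v < j.+1%:R by exact: truncn_itv.
(* From [K <= T] and [x] being a natural number, [v^2 <= x <= x^2]; hence the chosen index stays
   below [J.+2]. *)
have vx : v <= x%:R.
  rewrite -(@ler_pXn2r _ 2) ?nnegrE // exprMn !sqr_sqrtr ?divr_ge0 ?(ltW T0) ?(ltW K0) //.
  rewrite mulrCA ; apply: (@le_trans _ _ (x%:R * 1)).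
    by rewrite ler_wpM2l // ler_pdivrMr // mul1r.
  by rewrite mulr1 -natrX ler_nat; nia.
have jJ : (j < J.+2)%N.
  have : (j%:R : R) <= x%:R by exact: le_trans vx.
  by rewrite ler_nat; lia.
have := @pexp_near_max R x%:R T K j.+1%:R T0 K0 x0 vj; rewrite -/v.
have -> : j.+1%:R <= v + 1 by rewrite -natr1 lerD2r.
move=> /(_ isT); rewrite -/(grid_pt K j) => near.
have TK : T / K <= L by rewrite ler_pdivrMr.
have := @ln_grid_mix_ge R K T J.+2 x j K0 jJ.
have := @ln_grid_wt R K j.
set d : nat := addn _ _ => wd mixge.
have dist : d%:R <= 2^-1 * (1 + pmax x%:R T) + 1.
  pose s := Num.sqrt K.
  have /andP[cs sc] : (grid_ctr K)%:R <= s < (grid_ctr K).+1%:R.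
    by apply: truncn_itv; rewrite sqrtr_ge0.
  have vs : (v - s) ^+ 2 <= pmax x%:R T.
    apply: le_trans (@hellinger_le_pmax R x%:R T T0 x0).
    have -> : Num.sqrt x%:R - Num.sqrt T =
              Num.sqrt T * (Num.sqrt (x%:R / T) - 1).
      rewrite mulrBr mulr1 -sqrtrM ?(ltW T0) //; congr (Num.sqrt _ - _).
      by field; rewrite gt_eqF.
    have -> : v - s = s * (Num.sqrt (x%:R / T) - 1) by rewrite mulrBr mulr1.
    rewrite !exprMn ler_wpM2r ?sqr_ge0 //.
    by rewrite !sqr_sqrtr ?(ltW T0) ?(ltW K0).
  have : d%:R <= `|v - s| + 1.
    rewrite /d natrD; move: sc vj; rewrite -!natr1 => sc vj.
    case: (leqP j (grid_ctr K)) => jc.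
      rewrite (eqP jc) add0r natrB // -normrN opprB.
      by have := ler_norm (s - v); lra.
    move: (ltnW jc) => jc'.
    rewrite (eqP jc') addr0 natrB //.
    by have := ler_norm (v - s); lra.
  move=> dv; apply: le_trans dv _; rewrite lerD2r.
  have := sqr_ge0 (`|v - s| - 1); rewrite sqrrB1 real_normK ?num_real //; lra.
by lra.
Qed.

(** For a pair that never occurs the exponent is 0 everywhere; at [K = 1] the central index is 1, of
    weight [1 / 4]. *)
Lemma grid_mix0_bound {R : realType} (J : nat) :
  -2 <= ln (grid_mix (1 : R) J.+2 0 0).
Proof.
have := @ln_grid_mix_ge R 1 0 J.+2 0 1 ltr01 isT.
have := @ln_grid_wt R 1 1.
rewrite /grid_ctr sqrtr1 Num.Theory.trunc1 subnn /pexp mul0r mulr0; lra.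
Qed.

(** * Cylinders and Ville's inequality *)

Lemma finite_set_finType (T : finType) (D : set T) : finite_set D.
Proof. by apply: sub_finite_set (finite_finpred predT). Qed.

Section cylinders.
Context {R : realType} {A : alphabetType}.
Implicit Types (P : probability (pathspace A) R) (w : pathspace A).

Definition agree (n : nat) (w w' : nat -> A) :=
  forall i, (i < n)%N -> w i = w' i.

Lemma block_agree w w' (m n r : nat) : (m + r <= n)%N ->
  agree n w w' -> block w m r = block w' m r.
Proof.
move=> mrn ww'; apply: eq_from_tnth => i; rewrite !tnth_mktuple; apply: ww'.
by apply: leq_trans mrn; rewrite ltn_add2l.
Qed.

Lemma block0E w w' n : block w 0 n = block w' 0 n <-> agree n w w'.
Proof.
split=> [E i ni|]; last exact: block_agree.
by have := congr1 (fun t => tnth t (Ordinal ni)) E; rewrite !tnth_mktuple.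
Qed.

Lemma measurable_coord (k : nat) (b : A) :
  measurable [set w : pathspace A | w k = b].
Proof.
apply: sub_sigma_algebra.
have -> : [set w : nat -> A | w k = b] = (fun w => w k) @^-1` [set b] by [].
apply: (@open_comp (prod_topology (fun=> discrete_topology A)) (discrete_topology A)).
  by move=> w _; exact: (@proj_continuous nat (fun=> discrete_topology A) k).
exact: discrete_open.
Qed.

Lemma measurable_block_event m r (a : r.-tuple A) :
  measurable (block_event m a).
Proof.
have -> : block_event m a =
    \bigcap_(i in [set: 'I_r]) [set w : pathspace A | w (m + i)%N = tnth a i].
  apply/seteqP; split=> w /=.
    by move=> <- i _; rewrite tnth_mktuple.
  by move=> wa; apply: eq_from_tnth => i; rewrite tnth_mktuple wa.
apply: fin_bigcap_measurable => [|i _]; last exact: measurable_coord.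
exact: finite_set_finType.
Qed.

(** A set determined by [n] letters is a union of cylinders over words of length [n], of which there
    are finitely many. *)
Lemma measurable_agree n (D : set (pathspace A)) :
  (forall w w', agree n w w' -> D w -> D w') -> measurable D.
Proof.
move=> locD.
have -> : D = \bigcup_(t in [set t : n.-tuple A | exists2 w, D w & block w 0 n = t])
    block_event 0 t.
  apply/seteqP; split=> w /=; first by move=> Dw; exists (block w 0 n) => //; exists w.
  by move=> [t [w' Dw' <-]] /esym /block0E ww'; exact: locD Dw'.
apply: fin_bigcup_measurable => [|i _]; last exact: measurable_block_event.
exact: finite_set_finType.
Qed.

Lemma prob_ge0 P E : 0 <= prob P E.
Proof. by rewrite fine_ge0. Qed.

Lemma probE P E : measurable E -> P E = (prob P E)%:E.
Proof. by move=> mE; rewrite fineK // fin_num_measure. Qed.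

Lemma prob_le P E F : measurable E -> measurable F -> E `<=` F ->
  prob P E <= prob P F.
Proof.
by move=> mE mF EF; rewrite -lee_fin -!probE //; apply: le_measure; rewrite ?inE.
Qed.

Lemma prob_set0 P : prob P set0 = 0.
Proof. by rewrite /prob measure0. Qed.

Lemma prob_setT P : prob P setT = 1.
Proof. by rewrite /prob probability_setT. Qed.

Lemma prob_setU_le P E F : measurable E -> measurable F ->
  prob P (E `|` F) <= prob P E + prob P F.
Proof.
move=> mE mF; rewrite -lee_fin EFinD -!probE //; last exact: measurableU.
exact: measureU2.
Qed.

Lemma prob_bigcup_le P (I : finType) (F : I -> set (pathspace A)) :
  (forall i, measurable (F i)) ->
  prob P (\bigcup_i F i) <= \sum_i prob P (F i).
Proof.
move=> mF.
have -> : \bigcup_i F i = \big[setU/set0]_i F i.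
  by rewrite -bigcup_seq; apply: eq_bigcupl; split=> i //= _; rewrite mem_index_enum.
elim: (index_enum I) => [|i s IH]; first by rewrite !big_nil prob_set0.
rewrite !big_cons; apply: le_trans (prob_setU_le _ _ _) _ => //.
  exact: bigsetU_measurable.
by rewrite lerD2l.
Qed.

Lemma prob_bigcup P (I : finType) (F : I -> set (pathspace A)) :
  (forall i, measurable (F i)) -> trivIset setT F ->
  prob P (\bigcup_i F i) = \sum_i prob P (F i).
Proof.
move=> mF tF; apply: EFin_inj; rewrite -probE; last first.
  exact: fin_bigcup_measurable (finite_set_finType _) _.
rewrite measure_fin_bigcup //; last exact: finite_set_finType.
rewrite (@fsbig_fwiden _ _ _ _ (index_enum I)) ?index_enum_uniq //.
- by rewrite -sumEFin; apply: eq_bigr => i _; exact: probE.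
- by move=> i _ /=; rewrite mem_index_enum.
- by move=> i [_ []].
Qed.

Definition cyl (n : nat) (w : nat -> A) : set (pathspace A) :=
  block_event 0 (block w 0 n).

Lemma cylE n w w' : cyl n w w' <-> agree n w' w.
Proof. exact: block0E. Qed.

Lemma measurable_cyl n w : measurable (cyl n w).
Proof. exact: measurable_block_event. Qed.

Lemma cyl_agree n w w' : agree n w w' -> cyl n w = cyl n w'.
Proof. by move=> /block0E E; rewrite /cyl E. Qed.

Definition upd (w : nat -> A) (n : nat) (b : A) : nat -> A :=
  fun i => if i == n then b else w i.

Lemma upd_agree w n b : agree n (upd w n b) w.
Proof. by move=> i ni; rewrite /upd ltn_eqF. Qed.

Lemma upd_eq w n b : upd w n b n = b.
Proof. by rewrite /upd eqxx. Qed.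

Lemma cylS n w : cyl n w = \bigcup_b cyl n.+1 (upd w n b).
Proof.
apply/seteqP; split=> w' /=.
  move=> /cylE ww'; exists (w' n) => //; apply/cylE => i.
  rewrite ltnS leq_eqVlt => /predU1P[->|ni]; first by rewrite upd_eq.
  by rewrite upd_agree // ww'.
move=> [b _ /cylE ww']; apply/cylE => i ni; rewrite ww'; last exact: leqW.
exact: upd_agree.
Qed.

Lemma trivIset_cylS n w : trivIset setT (fun b => cyl n.+1 (upd w n b)).
Proof.
move=> b b' _ _ [w' [/cylE wb /cylE wb']].
by rewrite -(upd_eq w n b) -wb // wb' // upd_eq.
Qed.

Lemma prob_cylS P n w :
  \sum_b prob P (cyl n.+1 (upd w n b)) = prob P (cyl n w).
Proof.
rewrite cylS prob_bigcup // => [b|]; first exact: measurable_cyl.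
exact: trivIset_cylS.
Qed.

(** The supermartingale property is stated on the atoms of the filtration: a cylinder is compared
    with its one-letter extensions, so no conditional expectation is involved. The proof is by
    induction on the remaining horizon [m], simultaneously for all cylinders. *)
Lemma ville P (V : nat -> pathspace A -> R) (lam : R) :
  0 < lam ->
  (forall n w, 0 <= V n w) ->
  (forall n w w', agree n w w' -> V n w = V n w') ->
  (forall n w, \sum_b prob P (cyl n.+1 (upd w n b)) * V n.+1 (upd w n b) <=
               prob P (cyl n w) * V n w) ->
  forall N, prob P [set w | exists2 n, (n <= N)%N & lam <= V n w] <=
            V 0 (fun=> point) / lam.
Proof.
move=> lam0 V0 Vloc Vsup N.
pose D n m := [set w : pathspace A | exists2 i, (n <= i <= n + m)%N & lam <= V i w].
have mD n m : measurable (D n m).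
  apply: (@measurable_agree (n + m)) => w w' ww' [i /andP[ni im] lV].
  exists i; first by rewrite ni.
  by rewrite -(Vloc i w) // => j ji; apply: ww'; exact: leq_trans im.
have main m : forall n w, lam * prob P (cyl n w `&` D n m) <= prob P (cyl n w) * V n w.
  have small k n w : prob P (cyl n w `&` D n k) <= prob P (cyl n w).
    apply: prob_le; [|exact: measurable_cyl|by move=> ? []].
    by apply: measurableI => //; exact: measurable_cyl.
  elim: m => [|m IH] n w; have [lV|Vl] := leP lam (V n w).
  - by rewrite mulrC ler_pM ?prob_ge0 ?(ltW lam0) // small.
  - have -> : cyl n w `&` D n 0 = set0.
      rewrite -subset0 => w' [/cylE ww' [i]]; rewrite addn0 -eqn_leq => /eqP <-.
      by rewrite (Vloc _ _ _ ww') leNgt Vl.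
    by rewrite prob_set0 mulr0 mulr_ge0 ?prob_ge0.
  - by rewrite mulrC ler_pM ?prob_ge0 ?(ltW lam0) // small.
  (* Here [V n w < lam], so the crossing occurs after time [n], inside one of the one-letter
     extensions, where the induction hypothesis applies. *)
  - apply: le_trans (Vsup n w).
    apply: (@le_trans _ _ (lam * \sum_b prob P (cyl n.+1 (upd w n b) `&` D n.+1 m))).
      rewrite ler_wpM2l ?(ltW lam0) //.
      have mI b : measurable (cyl n.+1 (upd w n b) `&` D n.+1 m).
        by apply: measurableI => //; exact: measurable_cyl.
      apply: le_trans (prob_bigcup_le _ _) => //.
      apply: prob_le.
      + by apply: measurableI => //; exact: measurable_cyl.
      + exact: fin_bigcup_measurable (finite_set_finType _) _.
      rewrite cylS => w' [[b _ wb] [i /andP[ni im] lV]]; exists b => //; split => //.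
      exists i => //; rewrite addSnnS im andbT ltn_neqAle ni andbT.
      apply/eqP => nE; move: lV; rewrite -nE (Vloc _ _ w) ?leNgt ?Vl //.
      by move: wb => /cylE wb j jn; rewrite wb ?upd_agree // leqW.
    by rewrite mulr_sumr; apply: ler_sum => b _; exact: IH.
rewrite ler_pdivlMr // mulrC.
have := main N 0%N (fun=> point).
have -> : cyl 0 (fun=> point) = setT.
  by apply/seteqP; split => // w _; apply/cylE.
by rewrite setTI prob_setT mul1r; apply: le_trans.
Qed.

Lemma prob_block_event P m r (a : r.-tuple A) : stationary P ->
  prob P (block_event m a) = prob P (block_event 0 a).
Proof.
move=> stP; elim: m => // m <-.
rewrite /prob -(stP (block_event m a)); last exact: measurable_block_event.
congr (fine (P _)); apply/seteqP; split=> w /= <-;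
  by apply: eq_from_tnth => i; rewrite !tnth_mktuple.
Qed.

(** There are only countably many cylinders, so those of probability zero form a null set. Off it,
    all logarithms along the path are genuine. *)
Lemma ae_cyl_gt0 P : {ae P, forall w : pathspace A, forall n, 0 < prob P (cyl n w)}.
Proof.
have : P.-negligible (\bigcup_n \bigcup_(t in [set t : n.-tuple A |
    prob P (block_event 0 t) = 0]) block_event 0 t).
  apply: negligible_bigcup => n.
  exists (\bigcup_(t in [set t : n.-tuple A | prob P (block_event 0 t) = 0])
    block_event 0 t); split=> //.
    apply: fin_bigcup_measurable => [|t _]; last exact: measurable_block_event.
    exact: finite_set_finType.
  (* Replacing the words of positive probability by [set0] gives a union over a whole finite type,
     to which the union bound applies. *)
  pose F (t : n.-tuple A) := if prob P (block_event 0 t) == 0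
     then block_event 0 t else set0.
  have mF t : measurable (F t).
    by rewrite /F; case: ifP => // _; exact: measurable_block_event.
  have -> : \bigcup_(t in [set t : n.-tuple A | prob P (block_event 0 t) = 0])
    block_event 0 t = \bigcup_t F t.
    apply/seteqP; split=> w [t /= pt wt]; exists t => //; move: wt; rewrite /F.
      by rewrite pt eqxx.
    by case: eqP.
    by case: eqP.
  apply: (etrans (probE _ (fin_bigcup_measurable (finite_set_finType _) _))) => //.
  congr EFin; apply/eqP; rewrite eq_le prob_ge0 andbT.
  apply: le_trans (prob_bigcup_le _ _) _ => //.
  rewrite big1 // => t _; rewrite /F; case: eqP => // _; exact: prob_set0.
apply: negligibleS => w /= /existsNP[n /negP]; rewrite -leNgt => pn.
exists n => //; exists (block w 0 n) => //=.
by apply/eqP; rewrite eq_le pn prob_ge0.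
Qed.

End cylinders.

(** * Mixtures of exponential supermartingales *)

Lemma prod_count {R : comNzRingType} (T : finType) (y : nat -> T) (G : T -> R)
    (m n : nat) :
  \prod_(m <= i < n) G (y i) = \prod_t G t ^+ (\sum_(m <= i < n) (y i == t)).
Proof.
under [RHS]eq_bigr do rewrite -prodrXr.
rewrite exchange_big /=; apply: eq_bigr => i _.
rewrite (bigD1 (y i)) //= eqxx expr1 big1 ?mulr1 // => t.
by rewrite eq_sym => /negbTE ->.
Qed.

Lemma sum_count {R : nmodType} (T : finType) (y : nat -> T) (G : T -> R)
    (m n : nat) :
  \sum_(m <= i < n) G (y i) = \sum_t G t *+ (\sum_(m <= i < n) (y i == t))%N.
Proof.
under [RHS]eq_bigr do rewrite -sumrMnr.
rewrite exchange_big /=; apply: eq_bigr => i _.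
rewrite (bigD1 (y i)) //= eqxx mulr1n big1 ?addr0 // => t.
by rewrite eq_sym => /negbTE ->.
Qed.

Section counts.
Context {A : alphabetType} {r : nat}.
Implicit Types (w : nat -> A) (ab : r.-tuple A * A).

Definition trans w (i : nat) : r.-tuple A * A := (block w (i - r) r, w i).

Definition cnt w (n : nat) ab : nat := \sum_(r <= i < n) (trans w i == ab).

Lemma trans_agree w w' n i : (r <= i < n)%N -> agree n w w' -> trans w i = trans w' i.
Proof.
move=> /andP[ri ni] ww'; congr pair; last exact: ww'.
by apply: block_agree ww'; rewrite subnK // ltnW.
Qed.

Lemma occE w n (a : r.-tuple A) : occ w n a = \sum_b cnt w n (a, b).
Proof.
rewrite exchange_big; apply: eq_bigr => i _.
rewrite (bigD1 (w i)) //= xpair_eqE eqxx andbT big1 => [|b]; first exact/esym/addn0.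
by rewrite xpair_eqE eq_sym => /negbTE ->; rewrite andbF.
Qed.

Lemma cnt_le w n ab : (cnt w n ab <= n)%N.
Proof.
apply: leq_trans (leq_subr r n); rewrite -[leqRHS]muln1 -[leqRHS]sum_nat_const_nat.
by apply: leq_sum => i _; exact: leq_b1.
Qed.

End counts.

Lemma occ_le {A : alphabetType} (w : nat -> A) (n n' r : nat) (a : r.-tuple A) :
  (n <= n')%N -> (occ w n a <= occ w n' a)%N.
Proof.
move=> nn'; have [rn|nr] := leqP r n; last by rewrite /occ big_geq // ltnW.
by rewrite /occ (big_cat_nat rn nn') leq_addr.
Qed.

Section mixture.
Context {R : realType} {A : alphabetType}.
Variables (P : probability (pathspace A) R) (r : nat).
Variable p : r.-tuple A * A -> R.
Hypothesis p_sum : forall a, \sum_b p (a, b) = 1.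
Hypothesis prob_cyl_trans : forall n w, (r <= n)%N ->
  prob P (cyl n.+1 w) = prob P (cyl n w) * p (trans w n).

Lemma trans_upd n (w : nat -> A) c : (r <= n)%N ->
  trans (upd w n c) n = (block w (n - r) r, c).
Proof.
move=> rn; rewrite /trans upd_eq; congr pair.
by apply: block_agree (@upd_agree _ w n c); rewrite subnK.
Qed.

(** This is below the exact normaliser, the inverse of [\sum_b g (a, b) * p (a, b)] when that sum is
    positive; unlike it, it factors over the letters [b]. *)
Definition tilt (g : r.-tuple A * A -> R) (a : r.-tuple A) : R :=
  expR (- \sum_b (g (a, b) - 1) * p (a, b)).

Definition tilted (g : r.-tuple A * A -> R) (n : nat) (w : nat -> A) : R :=
  \prod_(r <= i < n) (g (trans w i) * tilt g (trans w i).1).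

Lemma tiltedE g n w : tilted g n w = \prod_ab (g ab ^+ cnt w n ab *
  expR (- ((g ab - 1) * ((occ w n ab.1)%:R * p ab)))).
Proof.
rewrite /tilted !big_split /= (prod_count (trans w)); congr *%R.
rewrite (prod_count (fun i => (trans w i).1)) /=.
transitivity (\prod_a \prod_b expR (- ((g (a, b) - 1) *
   ((occ w n a)%:R * p (a, b))))); last first.
  by rewrite pair_bigA; apply: eq_bigr => -[].
apply: eq_bigr => a _.
rewrite -expR_sum -expRM_natl mulrN mulr_sumr sumrN; congr (expR (- _)).
by apply: eq_bigr => b _; rewrite mulrCA.
Qed.

Lemma tilted_ge0 g n w : (forall ab, 0 <= g ab) -> 0 <= tilted g n w.
Proof. by move=> g0; apply: prodr_ge0 => i _; rewrite mulr_ge0 // expR_ge0. Qed.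

Lemma tilted_agree g n w w' : agree n w w' -> tilted g n w = tilted g n w'.
Proof.
by move=> ww'; apply: eq_big_nat => i ri; rewrite (trans_agree ri ww').
Qed.

(* Poissonisation: [\sum_c p_c g_c = 1 + z <= expR z] with [z = \sum_c p_c (g_c - 1)]. *)
Lemma tilted_step g n w : (forall ab, 0 <= g ab) ->
  \sum_c prob P (cyl n.+1 (upd w n c)) * tilted g n.+1 (upd w n c) <=
  prob P (cyl n w) * tilted g n w.
Proof.
move=> g0; have [rn|nr] := leqP r n; last first.
  rewrite [tilted g n w]big_geq ?(ltnW nr) // mulr1.
  under eq_bigr do rewrite [tilted _ _ _]big_geq // mulr1.
  by rewrite prob_cylS.
set a := block w (n - r) r.
have stepE c : prob P (cyl n.+1 (upd w n c)) * tilted g n.+1 (upd w n c) =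
    prob P (cyl n w) * tilted g n w * (p (a, c) * g (a, c) * tilt g a).
  rewrite prob_cyl_trans // /tilted big_nat_recr // !trans_upd // -/a /=.
  rewrite -!/(tilted _ _ _) (tilted_agree g (@upd_agree _ w n c)).
  rewrite (cyl_agree (@upd_agree _ w n c)) ; ring.
under eq_bigr do rewrite stepE.
rewrite -mulr_sumr -mulr_suml ler_piMr ?mulr_ge0 ?prob_ge0 ?tilted_ge0 //.
rewrite /tilt; set z := \sum_b (g (a, b) - 1) * _.
have -> : \sum_c p (a, c) * g (a, c) = 1 + z.
  rewrite -(p_sum a) -big_split /=; apply: eq_bigr => c _; ring.
by rewrite expRN ler_pdivrMr ?expR_gt0 // mul1r expR_ge1Dx.
Qed.

Variables (K : r.-tuple A * A -> R) (J : nat).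
Hypothesis K_gt0 : forall ab, 0 < K ab.

Definition mixture (n : nat) (w : pathspace A) : R :=
  \prod_ab grid_mix (K ab) J (cnt w n ab) ((occ w n ab.1)%:R * p ab).

Let wt (f : {ffun r.-tuple A * A -> 'I_J}) : R := \prod_ab grid_wt (K ab) (f ab).
Let pt (f : {ffun r.-tuple A * A -> 'I_J}) ab : R := grid_pt (K ab) (f ab).

Let pt_ge0 f ab : 0 <= pt f ab.
Proof. by rewrite ltW // grid_pt_gt0. Qed.

Let wt_ge0 f : 0 <= wt f.
Proof. by apply: prodr_ge0 => ab _; exact: grid_wt_ge0. Qed.

(** Distributing the product over the sums turns independent mixing at each pair into one mixture
    over all assignments [f] of grid points, hence a nonnegative combination of the supermartingales
    [tilted]. *)
Lemma mixtureE n w : mixture n w = \sum_f wt f * tilted (pt f) n w.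
Proof.
rewrite /mixture /grid_mix bigA_distr_bigA; apply: eq_bigr => f _.
by rewrite tiltedE -big_split.
Qed.

Lemma mixture_agree n w w' : agree n w w' -> mixture n w = mixture n w'.
Proof.
move=> ww'; rewrite !mixtureE; apply: eq_bigr => f _.
by rewrite (tilted_agree _ ww').
Qed.

Lemma mixture0_le1 w : mixture 0 w <= 1.
Proof.
rewrite mixtureE; under eq_bigr do rewrite /tilted big_geq // mulr1.
rewrite -(bigA_distr_bigA (fun ab (j : 'I_J) => grid_wt (K ab) j)).
apply: prodr_ile1 => ab _; rewrite sum_grid_wt sumr_ge0 // => j _.
exact: grid_wt_ge0.
Qed.

Lemma mixture_maximal (lam : R) (N : nat) : 0 < lam ->
  prob P [set w | exists2 n, (n <= N)%N & lam <= mixture n w] <= lam^-1.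
Proof.
move=> lam0.
have V0 n w : 0 <= mixture n w.
  by rewrite mixtureE sumr_ge0 // => f _; rewrite mulr_ge0 // tilted_ge0.
apply: (@le_trans _ _ (mixture 0 (fun=> point) / lam)); last first.
  by rewrite ler_piMl ?invr_ge0 ?(ltW lam0) // mixture0_le1.
apply: ville => // n w => [w'|]; first exact: mixture_agree.
under eq_bigr do rewrite mixtureE mulr_sumr.
rewrite exchange_big mixtureE mulr_sumr; apply: ler_sum => f _.
under eq_bigr do rewrite mulrCA.
rewrite -mulr_sumr [leRHS]mulrCA ler_wpM2l //.
exact: tilted_step.
Qed.

End mixture.

(** * Likelihood ratio along a typical path *)

Lemma sum_inv_consecutive {R : realType} (n : nat) :
  \sum_(0 <= k < n) (k.+1%:R * k.+2%:R)^-1 = 1 - n.+1%:R^-1 :> R.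
Proof.
elim: n => [|n IH]; first by rewrite big_geq // invr1 subrr.
rewrite big_nat_recr //= IH -!natr1.
have : 0 <= (n%:R : R) by [].
by move: (n%:R) => x x0; field; lra.
Qed.

(** First Borel-Cantelli lemma; the bounds telescope to a total of at most 1. *)
Lemma ae_eventually_not {R : realType} {A : alphabetType}
    (P : probability (pathspace A) R) (F : nat -> set (pathspace A)) :
  (forall k, measurable (F k)) ->
  (forall k, prob P (F k) <= (k.+1%:R * k.+2%:R)^-1) ->
  {ae P, forall w, \forall k \near \oo, ~ F k w}.
Proof.
move=> mF PF; exists (lim_sup_set F); split.
- by apply: bigcap_measurableType => // k _; exact: bigcup_measurable.
- apply: lim_sup_set_cvg0 => //.
  apply: (@le_lt_trans _ _ 1%E); last exact: ltry.
  apply: lime_le; first exact: is_cvg_nneseries.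
  apply: nearW => n.
  rewrite (eq_bigr (fun i => (prob P (F i))%:E)) => [|i _]; last exact: probE.
  rewrite sumEFin lee_fin; apply: (@le_trans _ _ (1 - n.+1%:R^-1)).
    by rewrite -sum_inv_consecutive; apply: ler_sum => k _; exact: PF.
  by rewrite lerBlDr lerDl invr_ge0.
- move=> w /= nF n _; apply: contrapT => nFn; apply: nF.
  by exists n => // k /= nk Fk; apply: nFn; exists k.
Qed.

Lemma ln_prod {R : realType} (I : Type) (s : seq I) (Q : pred I) (F : I -> R) :
  (forall i, Q i -> 0 < F i) ->
  ln (\prod_(i <- s | Q i) F i) = \sum_(i <- s | Q i) ln (F i).
Proof.
move=> F0; elim: s => [|i s IH]; first by rewrite !big_nil ln1.
rewrite !big_cons; case: ifP => // Qi.
by rewrite lnM ?posrE ?F0 ?prodr_gt0 ?IH.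
Qed.

Lemma grid_mix_gt0 {R : realType} (K : R) (J x : nat) (T : R) : 0 < K ->
  0 < grid_mix K J.+1 x T.
Proof.
move=> K0; rewrite /grid_mix big_ord_recl ltr_wpDr //.
  apply: sumr_ge0 => j _; rewrite mulr_ge0 ?grid_wt_ge0 // mulr_ge0 ?expR_ge0 //.
  by rewrite exprn_ge0 // ltW // grid_pt_gt0.
rewrite mulr_gt0 ?divr_gt0 ?exprn_gt0 ?invr_gt0 // mulr_gt0 ?expR_gt0 //.
by rewrite exprn_gt0 // grid_pt_gt0.
Qed.

(** Lets a kernel of order [s] be read as one of order [r]. For [s <= r] the default [point] is
    never reached. *)
Definition suffix {A : alphabetType} (s r : nat) (a : r.-tuple A) : s.-tuple A :=
  [tuple nth point a (r - s + i) | i < s].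

Lemma suffix_block {A : alphabetType} (w : nat -> A) (s r n : nat) :
  (s <= r)%N -> (r <= n)%N ->
  suffix s (block w (n - r) r) = block w (n - s) s.
Proof.
move=> sr rn; apply: eq_from_tnth => i; rewrite !tnth_mktuple.
have ri : (r - s + i < r)%N by have := ltn_ord i; lia.
rewrite -(tnth_nth _ _ (Ordinal ri)) tnth_mktuple /=; congr w; lia.
Qed.

Lemma typical_bounds {R : realType} (q x N r eta : R) : 0 < q -> r < N ->
  `| q^-1 * (x / (N - r)) - 1 | < eta ->
  (1 - eta) * q * (N - r) <= x /\ x <= (1 + eta) * q * (N - r).
Proof.
move=> q0 rN; have Nr0 : 0 < N - r by rewrite subr_gt0.
have qN : 0 < q * (N - r) by rewrite mulr_gt0.
rewrite (_ : q^-1 * _ = x / (q * (N - r))); last by field; rewrite !gt_eqF.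
rewrite ltr_norml => /andP[lo hi]; rewrite -!mulrA; split.
  by rewrite -ler_pdivlMr //; lra.
by rewrite -ler_pdivrMr //; lra.
Qed.

Section path_bound.
Context {R : realType} {A : alphabetType}.
Variables (P : probability (pathspace A) R) (r : nat) (eta : R).
Variable p : r.-tuple A * A -> R.
Hypothesis eta_lt1 : eta < 1.
Hypothesis stP : stationary P.
Hypothesis p_ge0 : forall ab, 0 <= p ab.
Hypothesis p_sum : forall a, \sum_b p (a, b) = 1.
Hypothesis prob_cyl_trans : forall n w, (r <= n)%N ->
  prob P (cyl n.+1 w) = prob P (cyl n w) * p (trans w n).

(* Lower bound on [N_a p_ab] given by typicality at time [2 ^ k]. *)
Definition count_scale (k : nat) (ab : r.-tuple A * A) : R :=
  (1 - eta) * prob P (block_event 0 ab.1) * ((2 ^ k)%N%:R - r%:R) * p ab.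

(* The value 1 is used for pairs that almost surely never occur. *)
Definition scale (k : nat) (ab : r.-tuple A * A) : R :=
  if 0 < count_scale k ab then count_scale k ab else 1.

(** The scales depend on [k] but not on the path or on [n], which keeps the mixture a
    supermartingale. Counts up to time [2 ^ k.+1] are at most [2 ^ k.+1], which fixes the grid
    size. *)
Definition block_mixture (k : nat) : nat -> pathspace A -> R :=
  mixture p (scale k) (2 ^ k.+1).+2.

Lemma scale_gt0 k ab : 0 < scale k ab.
Proof. by rewrite /scale; case: ifP. Qed.

Definition typical_at (N : nat) (w : pathspace A) :=
  forall a : r.-tuple A, 0 < prob P (block_event 0 a) ->
  `| (prob P (block_event 0 a))^-1 * ((occ w N a)%:R / (N%:R - r%:R)) - 1 | < eta.

(** The loss [3 * L + 4] of [grid_mix_bound] with [L = 6 / (1 - eta)]. For a word of probability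
    [x], the count lies between [(1 - eta) x (2^k - r)] and [(1 + eta) x (2^(k+1) - r)], and the
    latter is at most [6 x (2^k - r)] because [eta < 1] and [2 r <= 2^k]. *)
Definition mix_const : R := 3 * (6 / (1 - eta)) + 4.

Variables (w : pathspace A) (n k : nat).
Hypothesis wP : forall m, 0 < prob P (cyl m w).
Hypothesis kn : (2 ^ k <= n <= 2 ^ k.+1)%N.
Hypothesis rk : (2 * r <= 2 ^ k)%N.
Hypothesis typ : typical_at (2 ^ k) w.
Hypothesis typS : typical_at (2 ^ k.+1) w.

Let p_trans_gt0 i : (r <= i)%N -> 0 < p (trans w i).
Proof.
move=> ri; have := wP i.+1; rewrite prob_cyl_trans //.
by rewrite pmulr_rgt0.
Qed.

Let occ_eq0 (a : r.-tuple A) : prob P (block_event 0 a) = 0 -> occ w n a = 0%N.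
Proof.
move=> Pa; apply: big1_seq => i; rewrite mem_index_iota => /andP[_ /andP[ri _]].
case: eqP => // wa; have := wP i.
suff : prob P (cyl i w) <= 0 by move=> /le_lt_trans/[apply]; rewrite ltxx.
rewrite -Pa -(prob_block_event (i - r) a stP).
apply: prob_le; [exact: measurable_cyl|exact: measurable_block_event|].
move=> w' /cylE ww' /=; rewrite -wa; apply: block_agree ww'.
by rewrite subnK.
Qed.

Let cnt_eq0 ab : p ab = 0 -> cnt w n ab = 0%N.
Proof.
move=> pab; apply: big1_seq => i; rewrite mem_index_iota => /andP[_ /andP[ri _]].
case: eqP => // wab; have := p_trans_gt0 ri.
by rewrite wab pab ltxx.
Qed.

Let r_lt : (r < 2 ^ k)%N.
Proof. by have := expn_gt0 2 k; lia. Qed.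

(** Twice [grid_mix_bound] at [y = q / p ab], with typicality at both ends of the dyadic interval
    supplying the bounds on [N_a p_ab]. *)
Lemma term_bound (q : R) ab : 0 <= q -> ((0 < cnt w n ab)%N -> 0 < q) ->
  (cnt w n ab)%:R * (ln q - ln (p ab)) - (occ w n ab.1)%:R * (q - p ab) <=
  2 * (ln (grid_mix (scale k ab) (2 ^ k.+1).+2 (cnt w n ab)
        ((occ w n ab.1)%:R * p ab)) + mix_const).
Proof.
move=> q0 qcnt; case: ab qcnt => a b /= qcnt.
have L0 : 0 < 6 / (1 - eta) by rewrite divr_gt0 // subr_gt0.
(* If the scale is the default 1, then [N_ab] and [N_a p_ab] both vanish and the left side is
   [- N_a q <= 0]. *)
rewrite /scale /mix_const; case: ifP => [K0|/negbT]; last first.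
  rewrite -leNgt => Kle0.
  have {Kle0} : prob P (block_event 0 a) = 0 \/ p (a, b) = 0.
    have [->|pn0] := eqVneq (p (a, b)) 0; first by right.
    have [->|an0] := eqVneq (prob P (block_event 0 a)) 0; first by left.
    have : 0 < count_scale k (a, b); last by rewrite ltNge Kle0.
    rewrite !mulr_gt0 ?subr_gt0 ?ltr_nat // lt_neqAle eq_sym ?pn0 ?p_ge0 //.
    by rewrite an0 prob_ge0.
  move=> pa0; have c0 : cnt w n (a, b) = 0%N.
    case: pa0 => [/occ_eq0|]; last exact: cnt_eq0.
    by rewrite occE => /eqP; rewrite sum_nat_eq0 => /forallP /(_ b) /eqP.
  have T0 : (occ w n a)%:R * p (a, b) = 0.
    by case: pa0 => [/occ_eq0 ->|->]; rewrite ?mul0r ?mulr0.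
  rewrite c0 mul0r mulrBr T0 subr0 add0r.
  have := @grid_mix0_bound R (2 ^ k.+1).
  have : 0 <= (occ w n a)%:R * q by rewrite mulr_ge0.
  by lra.
have /andP[a0 pab0] : (0 < prob P (block_event 0 a)) && (0 < p (a, b)).
  rewrite !lt_neqAle prob_ge0 p_ge0 !andbT; apply/andP; split; apply/eqP => E;
  by move: K0; rewrite /count_scale /= -E ?(mulr0, mul0r) ltxx.
have rkR : r%:R < (2 ^ k)%N%:R :> R by rewrite ltr_nat.
have rk2 : 2 * r%:R <= (2 ^ k)%N%:R :> R by rewrite -natrM ler_nat.
have r0 : 0 <= r%:R :> R by [].
have kS : (2 ^ k.+1)%N%:R = 2 * (2 ^ k)%N%:R :> R by rewrite expnS natrM.
have [lo _] := typical_bounds a0 rkR (typ a0).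
have [|_ hi] := typical_bounds a0 _ (typS a0); first by rewrite kS; lra.
have /andP[kn1 kn2] := kn.
have occ1 : (occ w (2 ^ k) a)%:R <= (occ w n a)%:R :> R by rewrite ler_nat occ_le.
have occ2 : (occ w n a)%:R <= (occ w (2 ^ k.+1) a)%:R :> R by rewrite ler_nat occ_le.
have cJ : (cnt w n (a, b) <= 2 ^ k.+1)%N by exact: leq_trans (cnt_le _ _ _) kn2.
have KT : count_scale k (a, b) <= (occ w n a)%:R * p (a, b).
  by rewrite /count_scale ler_wpM2r // (le_trans lo).
have TLK : (occ w n a)%:R * p (a, b) <= 6 / (1 - eta) * count_scale k (a, b).
  rewrite /count_scale [leRHS]mulrA ler_wpM2r //.
  apply: (le_trans occ2); apply: (le_trans hi).
  rewrite kS; set x := prob _ _; set y := (2 ^ k)%N%:R; set z := r%:R.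
  have -> : 6 / (1 - eta) * ((1 - eta) * x * (y - z)) = x * (6 * (y - z)).
    by field; rewrite gt_eqF // subr_gt0.
  rewrite -mulrA mulrCA ler_wpM2l ?(ltW a0) //.
  apply: (@le_trans _ _ (2 * (2 * y - z))).
    rewrite ler_wpM2r //; first by rewrite /y /z; lra.
    by rewrite -[leRHS]/(1 + 1) lerD2l ltW.
  by rewrite /y /z; lra.
have ycnt : (0 < cnt w n (a, b))%N -> 0 < q / p (a, b).
  by move=> /qcnt ?; rewrite divr_gt0.
have := grid_mix_bound K0 (ltW L0) KT TLK cJ (divr_ge0 q0 (p_ge0 _)) ycnt.
rewrite ler_pdivrMl //; apply: le_trans; rewrite /pexp.
apply: lerB.
  (* If the pair does not occur, [q] may be 0 and the logarithm of the quotient need not split, but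
     it is multiplied by 0. *)
  have [c0|cpos] := posnP (cnt w n (a, b)); first by rewrite c0 !mul0r.
  by rewrite ln_div ?posrE ?qcnt.
rewrite le_eqVlt; apply/orP; left; apply/eqP.
by field; rewrite gt_eqF.
Qed.

Lemma loglik_ratio_bound (q : r.-tuple A * A -> R) :
  (forall ab, 0 <= q ab) -> (forall a, \sum_b q (a, b) = 1) ->
  (forall i, (r <= i < n)%N -> 0 < q (trans w i)) ->
  \sum_(r <= i < n) (ln (q (trans w i)) - ln (p (trans w i))) <=
  2 * (ln (block_mixture k n w) + (#|A| ^ r.+1)%:R * mix_const).
Proof.
move=> q0 q1 qw; rewrite (sum_count (trans w) (fun ab => ln (q ab) - ln (p ab))).
have qcnt ab : (0 < cnt w n ab)%N -> 0 < q ab.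
  rewrite lt0n => /eqP cn0; apply/negP => /negP; rewrite -leNgt => qle0.
  apply: cn0; apply: big1_seq => i; rewrite mem_index_iota => /andP[_ rin].
  by case: eqP => // wi; have := qw _ rin; rewrite wi ltNge qle0.
(* The subtracted correction sums to zero over each row; it makes every summand with [p ab > 0]
   equal to [pexp] at [q ab / p ab]. *)
apply: (@le_trans _ _ (\sum_ab ((cnt w n ab)%:R * (ln (q ab) - ln (p ab)) -
    (occ w n ab.1)%:R * (q ab - p ab)))).
  rewrite big_split /= sumrN.
  have -> : \sum_ab (occ w n ab.1)%:R * (q ab - p ab) = 0.
    transitivity (\sum_a \sum_b (occ w n a)%:R * (q (a, b) - p (a, b))).
      by rewrite pair_bigA; apply: eq_bigr => -[].
    apply: big1 => a _.
    by rewrite -mulr_sumr big_split /= sumrN q1 p_sum subrr mulr0.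
  by rewrite subr0; apply: ler_sum => ab _; rewrite mulr_natl.
apply: le_trans; first by apply: ler_sum => ab _; exact: term_bound (q0 ab) (@qcnt ab).
rewrite -mulr_sumr big_split /= -ln_prod => [|ab _]; last first.
  by rewrite grid_mix_gt0 // scale_gt0.
rewrite sumr_const card_prod card_tuple -expnSr -[mix_const *+ _]mulr_natl.
by [].
Qed.

End path_bound.

(** * Almost sure bounds uniform in the order *)

Section large_scale.
Context {R : realType} {A : alphabetType}.
Variables (P : probability (pathspace A) R) (eta : R) (rs : nat).
Variable Q : rs.-tuple A -> A -> R.
Hypothesis eta_lt1 : eta < 1.
Hypothesis stP : stationary P.
Hypothesis Q_ge0 : forall a b, 0 <= Q a b.
Hypothesis Q_sum : forall a, \sum_b Q a b = 1.
Hypothesis Q_prob : forall (x : nat -> A) (n : nat), (rs <= n)%N ->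
  prob P (block_event 0 (block x 0 n)) =
  prob P (block_event 0 (block x 0 rs)) *
    \prod_(rs <= i < n) Q (block x (i - rs) rs) (x i).

Definition ker (r : nat) (ab : r.-tuple A * A) : R := Q (suffix rs ab.1) ab.2.

Lemma ker_ge0 r (ab : r.-tuple A * A) : 0 <= ker ab.
Proof. exact: Q_ge0. Qed.

Lemma ker_sum r (a : r.-tuple A) : \sum_b ker (a, b) = 1.
Proof. exact: (Q_sum (suffix rs a)). Qed.

Lemma prob_cyl_ker r n w : (rs <= r)%N -> (r <= n)%N ->
  prob P (cyl n.+1 w) = prob P (cyl n w) * ker (@trans A r w n).
Proof.
move=> rsr rn; have rsn := leq_trans rsr rn.
rewrite /cyl Q_prob ?(leqW rsn) // [in RHS]Q_prob // big_nat_recr //= mulrA.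
by rewrite /ker /trans /= suffix_block.
Qed.

Definition threshold (k r : nat) : R := k.+1%:R * k.+2%:R * 2 ^+ r.+1.

Lemma threshold_gt0 k r : 0 < threshold k r.
Proof. by rewrite !mulr_gt0 // exprn_gt0. Qed.

Lemma sum_inv_threshold (k m : nat) :
  \sum_(r < m) (threshold k r)^-1 <= (k.+1%:R * k.+2%:R)^-1.
Proof.
have thrE r : (threshold k r)^-1 = (k.+1%:R * k.+2%:R)^-1 * (2^-1 * 2^-1 ^+ r).
  by rewrite /threshold exprVn exprS !invfM.
under eq_bigr do rewrite thrE.
rewrite -!mulr_sumr ler_piMr ?invr_ge0 ?mulr_ge0 //.
by have := sum_half_le2 (R := R) m; lra.
Qed.

Lemma ae_mixture_lt_threshold :
  {ae P, forall w, \forall k \near \oo, forall r n : nat,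
    (rs <= r < 2 ^ k)%N -> (n <= 2 ^ k.+1)%N ->
    block_mixture P eta (@ker r) k n w < threshold k r}.
Proof.
(* For each [k] the restriction [r < 2 ^ k] leaves a finite union; orders below [rs] contribute the
   empty event. *)
pose F k (r : 'I_(2 ^ k)) := [set w : pathspace A | (rs <= r)%N /\
  exists2 n, (n <= 2 ^ k.+1)%N &
    threshold k r <= block_mixture P eta (@ker r) k n w].
have mF k r : measurable (F k r).
  apply: (@measurable_agree _ (2 ^ k.+1)) => w w' ww' [rsr [n nk le]].
  split=> //; exists n => //; rewrite /block_mixture -(@mixture_agree _ _ _ _ _ _ _ w) //.
  by move=> i ni; apply: ww'; exact: leq_trans nk.
have PF k (r : 'I_(2 ^ k)) : prob P (F k r) <= (threshold k r)^-1.
  have [rsr|rrs] := leqP rs r; last first.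
    have -> : F k r = set0 by rewrite -subset0 => w []; rewrite leqNgt rrs.
    by rewrite prob_set0 invr_ge0 ltW // threshold_gt0.
  have small := @mixture_maximal R A P r (@ker r) (@ker_sum r)
    (fun n w => @prob_cyl_ker r n w rsr) (scale P eta (@ker r) k) (2 ^ k.+1).+2
    (scale_gt0 P eta (@ker r) k) (threshold k r) (2 ^ k.+1) (threshold_gt0 k r).
  apply: le_trans small.
  apply: prob_le; [exact: mF| |by move=> w []; exact].
  apply: (@measurable_agree _ (2 ^ k.+1)) => w w' ww' [n nk le].
  exists n => //; rewrite -(@mixture_agree _ _ _ _ _ _ _ w) //.
  by move=> i ni; apply: ww'; exact: leq_trans nk.
have mUF k : measurable (\bigcup_r F k r).
  exact: fin_bigcup_measurable (finite_set_finType _) _.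
have := @ae_eventually_not _ _ P (fun k => \bigcup_r F k r) mUF.
have small k : prob P (\bigcup_r F k r) <= (k.+1%:R * k.+2%:R)^-1.
  apply: le_trans (prob_bigcup_le _ _) _ => //.
  by apply: le_trans (sum_inv_threshold k (2 ^ k)); apply: ler_sum.
move=> /(_ small); apply: filterS => w; apply: filterS => k nF r n /andP[rsr rk] nk.
rewrite ltNge; apply/negP => le; apply: nF.
by exists (Ordinal rk) => //; split=> //; exists n.
Qed.

Variable w : pathspace A.
Hypothesis wP : forall m, 0 < prob P (cyl m w).

Lemma ln_prob_cyl r n : (rs <= r)%N -> (r <= n)%N ->
  ln (prob P (cyl n w)) =
  ln (prob P (cyl r w)) + \sum_(r <= i < n) ln (ker (@trans A r w i)).
Proof.
move=> rsr; elim: n => [|n IH].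
  by rewrite leqn0 => /eqP ->; rewrite big_geq // addr0.
rewrite leq_eqVlt => /predU1P[->|]; first by rewrite big_geq // addr0.
rewrite ltnS => rn; rewrite (prob_cyl_ker w rsr rn) big_nat_recr //= addrA -IH //.
have := wP n.+1; rewrite (prob_cyl_ker w rsr rn) pmulr_rgt0 // => k0.
by rewrite lnM ?posrE ?wP.
Qed.

Definition init_const : R :=
  `|ln (prob P (cyl rs w))| + \sum_a \sum_b `|ln (Q a b)|.

Lemma init_const_ge0 : 0 <= init_const.
Proof. by rewrite addr_ge0 // sumr_ge0 // => a _; rewrite sumr_ge0. Qed.

(** The transitions on the path are positive and take finitely many values, so each initial letter
    costs at most a constant. The total is linear in [r], which [#|A| ^ r] absorbs when there are at
    least two letters. *)
Lemma ln_prob_cyl_ge r : (rs <= r)%N ->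
  - (r.+1%:R * init_const) <= ln (prob P (cyl r w)).
Proof.
have c0 := init_const_ge0.
move=> rsr; apply: (@le_trans _ _ (- ((r - rs).+1%:R * init_const))).
  by rewrite lerN2 ler_wpM2r // ler_nat ltnS leq_subr.
rewrite -{2}(subnK rsr); elim: (r - rs)%N => [|m IH].
  rewrite mul1r add0n lerNl; apply: (@le_trans _ _ `|ln (prob P (cyl rs w))|).
    by rewrite -normrN ler_norm.
  by rewrite lerDl sumr_ge0 // => a _; rewrite sumr_ge0.
rewrite addSn; have rm : (rs <= m + rs)%N by rewrite leq_addl.
have := wP (m + rs).+1; rewrite (prob_cyl_ker w rm (leqnn _)) pmulr_rgt0 // => k0.
rewrite lnM ?posrE ?wP // -[m.+2%:R]natr1 mulrDl mul1r opprD lerD //.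
rewrite lerNl; apply: (@le_trans _ _ `|ln (ker (@trans A (m + rs) w (m + rs)))|).
  by rewrite -normrN ler_norm.
rewrite /init_const /ker; set a := suffix _ _; set b := _.2.
rewrite ler_wpDl // (bigD1 a) //= ler_wpDr ?sumr_ge0 // => [i _|].
  by rewrite sumr_ge0.
by rewrite (bigD1 b) //= ler_wpDr // sumr_ge0.
Qed.

(* The initial law of a chain in [Theta r] contributes a factor at most 1. *)
Lemma loglik_upper (P' : probability (pathspace A) R) (r n k : nat) :
  Theta r P' -> (rs <= r)%N ->
  (2 ^ k <= n <= 2 ^ k.+1)%N -> (2 * r <= 2 ^ k)%N ->
  typical_at P r eta (2 ^ k) w -> typical_at P r eta (2 ^ k.+1) w ->
  block_mixture P eta (@ker r) k n w < threshold k r ->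
  (lne (P' (block_event 0 (block w 0 n))) <=
   (ln (prob P (cyl n w)) + (r.+1%:R * init_const +
     2 * (ln (threshold k r) + (#|A| ^ r.+1)%:R * mix_const eta)))%:E)%E.
Proof.
move=> [q [q0 q1 _ qP]] rsr kn rk t1 t2 small.
have rn : (r <= n)%N by move: kn => /andP[]; lia.
rewrite probE; last exact: measurable_block_event.
rewrite /=; case: ifP => [_|/negbT]; first exact: leNye.
rewrite -ltNge qP // lee_fin.
set x := prob P' _; set y := \prod_(_ <= _ < _) _ => xy.
have y0 : 0 <= y by apply: prodr_ge0.
have x0 : 0 <= x by exact: prob_ge0.
have x1 : x <= 1.
  by rewrite -(prob_setT P'); apply: prob_le => //; exact: measurable_block_event.
have yp : 0 < y.
  by rewrite lt_neqAle y0 andbT eq_sym; apply: contraTneq xy => ->; rewrite mulr0 ltxx.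
have qw i : (r <= i < n)%N -> 0 < q (block w (i - r) r) (w i).
  move=> rin; rewrite lt_neqAle q0 andbT eq_sym.
  apply: contraTneq yp => qi; rewrite /y (big_rem i) /= ?mem_index_iota //.
  by rewrite qi mul0r ltxx.
apply: (@le_trans _ _ (ln y)).
  by rewrite ler_ln ?posrE // ler_piMl.
have -> : ln y = \sum_(r <= i < n) ln (q (block w (i - r) r) (w i)).
  rewrite /y big_nat_cond [RHS]big_nat_cond ln_prod // => i /andP[+ _]; exact: qw.
rewrite (ln_prob_cyl rsr rn).
have H := @loglik_ratio_bound _ _ P r eta (@ker r) eta_lt1 stP (@ker_ge0 r)
  (@ker_sum r) (fun n w => @prob_cyl_ker r n w rsr) w n k wP kn rk t1 t2
  (fun ab => q ab.1 ab.2) (fun ab => q0 ab.1 ab.2) q1 qw.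
move: H; rewrite sumrB /=.
set s1 := \sum_(_ <= _ < _) _; set s2 := \sum_(_ <= _ < _) _ => H.
have := ln_prob_cyl_ge rsr.
suff : ln (block_mixture P eta (@ker r) k n w) <= ln (threshold k r) by lra.
rewrite ler_ln ?posrE ?threshold_gt0 //; first exact: ltW.
by apply: prodr_gt0 => ab _; apply: grid_mix_gt0; exact: scale_gt0.
Qed.

End large_scale.

(** * Asymptotics and conclusion *)

Lemma ln_threshold_le {R : realType} (k r : nat) :
  ln (threshold k r : R) <= 2 * ln k.+2%:R + r.+1%:R.
Proof.
rewrite /threshold !lnM ?posrE ?mulr_gt0 ?exprn_gt0 // lnXn //.
have := @ln2_le1 R; set l := ln 2 => l1.
have : l *+ r.+1 <= r.+1%:R by rewrite -[l *+ _]mulr_natr ler_piMl.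
have : ln k.+1%:R <= ln k.+2%:R :> R by rewrite ler_ln ?posrE // ler_nat.
by lra.
Qed.

(** As [ln 2 >= 1 / 2], one has [k <= 2 ln n], so [k + 2 <= 4 ln n] once [ln n >= 1]; finally
    [ln 4 <= 2]. *)
Lemma ln_trunc_log_le {R : realType} (n k : nat) : (2 ^ k <= n)%N ->
  1 <= ln n%:R :> R -> ln k.+2%:R <= 2 + ln (ln n%:R) :> R.
Proof.
move=> kn ln1n.
have n0 : (0 < n)%N by apply: leq_trans kn; rewrite expn_gt0.
have half : 2^-1 <= ln 2 :> R.
  have := @ln_le_subr1 R 2^-1; rewrite invr_gt0 ltr0n lnV ?posrE // => /(_ isT); lra.
have : k%:R * ln 2 <= ln n%:R :> R.
  by rewrite mulr_natl -lnXn // ler_ln ?posrE ?exprn_gt0 ?ltr0n // -natrX ler_nat.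
have : k%:R * 2^-1 <= k%:R * ln 2 :> R by rewrite ler_wpM2l.
move=> k1 k2; have k4 : k.+2%:R <= 2 ^+ 2 * ln n%:R :> R.
  by rewrite -addn2 natrD expr2; lra.
apply: (@le_trans _ _ (ln (2 ^+ 2 * ln n%:R))).
  by rewrite ler_ln ?posrE // (lt_le_trans _ k4).
rewrite lnM ?posrE ?exprn_gt0 //; last lra.
rewrite lnXn //; have := @ln2_le1 R; lra.
Qed.

Lemma near_ln_ln_ge {R : realType} (M : R) :
  \forall n \near \oo, M <= ln (ln n%:R).
Proof.
near=> n.
have le1 : expR (expR M) <= n%:R by near: n; exact: nbhs_infty_ger.
have n0 : 0 < n%:R :> R by apply: lt_le_trans le1; exact: expR_gt0.
have le2 : expR M <= ln n%:R by rewrite -ler_expR lnK ?posrE.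
by rewrite -ler_expR lnK // posrE (lt_le_trans _ le2) ?expR_gt0.
Unshelve. all: by end_near. Qed.

Lemma near_trunc_log (F : nat -> Prop) :
  (\forall k \near \oo, F k) -> \forall n \near \oo, F (trunc_log 2 n).
Proof.
move=> [k0 _ Fk]; exists (2 ^ k0)%N => // n /= kn; apply: Fk => /=.
by rewrite -(trunc_expnK k0 (isT : 1 < 2)%N) leq_trunc_log.
Qed.

Theorem theorem2p3 (R : realType) (eta : R) (eta_lt1 : eta < 1) :
  exists2 C0 : R, 0 < C0 &
  forall (A : alphabetType) (rstar : nat) (Pstar : probability (pathspace A) R)
    (kappa : nat -> R),
    has_order Pstar rstar ->
    stationary Pstar ->
    irreducible Pstar rstar ->
    {homo kappa : m n / (m <= n)%N >-> m <= n} ->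
    (forall n : nat, kappa n <= n%:R / 4) ->
    large_scale_typical Pstar (fun n => kappa (2 * n)%N) eta ->
    {ae Pstar, forall w : pathspace A, \forall n \near \oo,
      (ereal_sup [set (((#|A| ^ r)%N%:R : R)^-1)%:E *
                      (max_loglik r n w - max_loglik rstar n w)
                 | r in [set r : nat | (rstar < r)%N /\ (r%:R < kappa n)%R]]
       <= (C0 * ln (ln n%:R))%:E)%E}.
Proof.
(* After division by [#|A| ^ r] the excess is at most [4 ln (ln n) + 10 + c + 2 m], where [m] is
   [#|A|] times [mix_const eta]. The terms free of [n] are eventually below one more [ln (ln n)]. *)
exists 5 => // A rs P kappa [[Q [Q0 Q1 Q2 QP]] _] stP _ kmono k4 typ.
have inTheta : Theta rs P by exists Q.
have smallmix := ae_mixture_lt_threshold eta Q1 QP.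
apply: filterS3 typ smallmix (ae_cyl_gt0 P) => w typ smallmix wP.
pose c := init_const P Q w.
have c0 : 0 <= c by exact: init_const_ge0.
have m0 : 0 <= mix_const eta.
  by rewrite /mix_const addr_ge0 // mulr_ge0 // divr_ge0 // subr_ge0 ltW.
pose typN (N : nat) := forall (r : nat) (a : r.-tuple A),
  r%:R < kappa (2 * N)%N -> 0 < prob P (block_event 0 a) ->
  `| (prob P (block_event 0 a))^-1 * ((occ w N a)%:R / (N%:R - r%:R)) - 1 | < eta.
have typ_pow : \forall k \near \oo, typN (2 ^ k)%N /\ typN (2 ^ k.+1)%N.
  case: typ => N _ typ; exists N => // k /= Nk; split; apply: typ => /=.
    by apply: leq_trans Nk _; rewrite ltnW // ltn_expl.
  apply: leq_trans Nk _; apply: leq_trans (ltnW (ltn_expl k (isT : 1 < 2)%N)) _.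
  by rewrite leq_exp2l.
near=> n.
have lnln : 10 + c + 2 * (#|A|%:R * mix_const eta) <= ln (ln n%:R).
  by near: n; exact: near_ln_ln_ge.
have n0 : (0 < n)%N by near: n; exact: nbhs_infty_gt.
have [] : typN (2 ^ trunc_log 2 n)%N /\ typN (2 ^ (trunc_log 2 n).+1)%N.
  by near: n; exact: (near_trunc_log typ_pow).
have : forall r m : nat, (rs <= r < 2 ^ trunc_log 2 n)%N ->
    (m <= 2 ^ (trunc_log 2 n).+1)%N ->
    block_mixture P eta (ker Q (r := r)) (trunc_log 2 n) m w <
      threshold (trunc_log 2 n) r.
  by near: n; exact: (near_trunc_log smallmix).
set k := trunc_log 2 n => smallk typk typSk.
have kn : (2 ^ k <= n)%N by exact: trunc_logP.
have nk : (n < 2 ^ k.+1)%N by exact: trunc_log_ltn.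
apply/ereal_supP => _ [r [rsr rk] <-].
have A0 : (0 < #|A|)%N by apply/card_gt0P; exists point.
have Ar0 : 0 < (#|A| ^ r)%N%:R :> R by rewrite ltr0n expn_gt0 A0.
have PnE : P (block_event 0 (block w 0 n)) = (prob P (cyl n w))%:E.
  by apply: probE; exact: measurable_cyl.
(* The true chain competes in the supremum of order [rs], so its own likelihood bounds that supremum
   from below. *)
have low : ((ln (prob P (cyl n w)))%:E <= max_loglik rs n w)%E.
  apply: ereal_sup_ubound; exists P => //.
  by rewrite PnE lne_EFin.
have rk2 : (2 * r <= 2 ^ k)%N.
  have : (4 * r)%:R < n%:R :> R by rewrite natrM; have := k4 n; lra.
  by rewrite ltr_nat; move: nk; rewrite expnS; lia.
have rk' : (r < 2 ^ k)%N by have := expn_gt0 2 k; lia.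
(* Since [n <= 2 * 2 ^ k], the cutoff [kappa (2 * N)] at the earlier time [N = 2 ^ k] still covers
   every [r] below [kappa n]. *)
have kap1 : r%:R < kappa (2 * 2 ^ k)%N.
  by apply: (lt_le_trans rk); apply: kmono; rewrite -expnS ltnW.
have kap2 : r%:R < kappa (2 * 2 ^ k.+1)%N.
  by apply: (lt_le_trans kap1); apply: kmono; rewrite (expnS 2 k); lia.
suff [X up Xle] : exists2 X : R,
    (max_loglik r n w <= (ln (prob P (cyl n w)) + X)%:E)%E &
    X <= (#|A| ^ r)%N%:R * (5 * ln (ln n%:R)).
  apply: (@le_trans _ _ (((#|A| ^ r)%N%:R^-1)%:E * X%:E)%E).
    apply: lee_wpmul2l; first by rewrite lee_fin invr_ge0 ltW.
    apply: le_trans (leeB up low) _.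
    by rewrite -EFinB lee_fin addrAC subrr add0r.
  by rewrite -EFinM lee_fin ler_pdivrMl.
have lnln0 : 0 <= ln (ln n%:R) :> R.
  by apply: le_trans lnln; apply: addr_ge0; [exact: addr_ge0|rewrite !mulr_ge0].
(* With a single letter [#|A| ^ r = 1] cannot absorb terms linear in [r]; but then there is only one
   path and every likelihood is 1. *)
have [A1|A2] := leqP #|A| 1.
  exists 0; last by rewrite !mulr_ge0 // ltW.
  have cylT : cyl n w = setT.
    apply/seteqP; split => // w' _; apply/cylE => i _.
    exact: (fintype_le1P A1 (w i) (w' i)).
  rewrite cylT prob_setT ln1 addr0; apply/ereal_supP => _ [P' _ <-].
  rewrite -/(cyl n w) cylT probability_setT.
  by rewrite lne_EFin // ln1.
have rA : (r.+1 <= #|A| ^ r)%N by exact: ltn_expl.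
exists (r.+1%:R * c +
     2 * (ln (threshold k r) + (#|A| ^ r.+1)%:R * mix_const eta)).
  apply/ereal_supP => _ [P' P'r <-].
  apply: loglik_upper => //; first exact: ltnW.
  - by rewrite kn ltnW.
  - by move=> a; exact: typk.
  - by move=> a; exact: typSk.
  - by apply: smallk; rewrite ?(ltnW rsr) ?rk' // ltnW.
have thr := @ln_threshold_le R k r.
have ln1n : 1 <= ln n%:R :> R.
  have [ln_pos|ln_neg] := ltP 0 (ln n%:R : R).
    by have := ln_le_subr1 ln_pos; lra.
  by move: lnln; rewrite (ln0 ln_neg); have := mulr_ge0 (ler0n R #|A|) m0; lra.
have klog := ln_trunc_log_le kn ln1n.
have rAR : r.+1%:R <= (#|A| ^ r)%N%:R :> R by rewrite ler_nat.
have one_le : 1 <= (#|A| ^ r)%N%:R :> R by rewrite ler1n expn_gt0 A0.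
rewrite expnSr natrM -mulrA.
set a := (#|A| ^ r)%N%:R in rAR one_le Ar0 *.
set m := _ * mix_const eta in lnln *.
have e1 : r.+1%:R * c <= a * c by rewrite ler_wpM2r.
have e2 : ln k.+2%:R <= a * ln k.+2%:R :> R.
  by rewrite ler_peMl // ln_ge0 // ler1n.
have e3 : a * ln k.+2%:R <= a * (2 + ln (ln n%:R)) by rewrite ler_pM2l.
apply: (@le_trans _ _ (a * (c + 2 * (2 * (2 + ln (ln n%:R)) + 1 + m)))).
  by lra.
rewrite ler_pM2l //; lra.
Unshelve. all: by end_near. Qed.
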